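(* The set $\{0,1\}^*$ is not existentially definable in the structure $(\{0,1,2\}^*,\varepsilon,0,1,2,{}^\frown,\mathcal{L},\mathcal{P})$, i.e. there is no existential formula $\phi(x)$ in the language $\{\varepsilon,0,1,2,{}^\frown,\mathcal{L},\mathcal{P}\}$ with only $x$ free such that for all $w\in\{0,1,2\}^*$, $\phi(w)$ holds in this structure iff $w\in\{0,1\}^*$.
   Context: $\{0,1,2\}^*$ is the set of finite strings over $\{0,1,2\}$, $\varepsilon$ the empty string, ${}^\frown$ concatenation, and $0,1,2$ denote the one-letter strings. $(u,v)\in\mathcal{L}$ iff $|u|\le|v|$ (length), and $(u,v)\in\mathcal{P}$ iff the number of occurrences of $0$ in $u$ equals the number of occurrences of $0$ in $v$. An existential formula is one built from atomic formulas and their negations using $\wedge,\vee$ and unbounded $\exists$; definitions are parameter-free. *)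

(* Defs.v *)
From mathcomp Require Import all_boot.

Set Implicit Arguments.
Unset Strict Implicit.
Unset Printing Implicit Defensive.

Definition letter : Type := 'I_3.
Definition letter0 : letter := @Ordinal 3 0 isT.
Definition letter1 : letter := @Ordinal 3 1 isT.
Definition letter2 : letter := @Ordinal 3 2 isT.

Definition word : Type := seq letter.

Definition len_le (u v : word) : Prop := size u <= size v.

Definition same_zeros (u v : word) : Prop :=
  count_mem letter0 u = count_mem letter0 v.

Inductive term : Type :=
| Var of nat
| Eps
| Zero
| One
| Two
| Cat of term & term.

(* The language has equality as a logical symbol. *)
Inductive atom : Type :=
| Eq of term & term
| LenLe of term & term
| SameZeros of term & term.

Inductive eformula : Type :=
| Atom of atom
| NegAtom of atom
| And of eformula & eformula
| Or of eformula & eformula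
| Exists of nat & eformula.

Fixpoint term_vars (t : term) : seq nat :=
  match t with
  | Var x => [:: x]
  | Cat s t => term_vars s ++ term_vars t
  | _ => [::]
  end.

Definition atom_vars (a : atom) : seq nat :=
  match a with
  | Eq s t | LenLe s t | SameZeros s t => term_vars s ++ term_vars t
  end.

Fixpoint free_vars (phi : eformula) : seq nat :=
  match phi with
  | Atom a | NegAtom a => atom_vars a
  | And phi psi | Or phi psi => free_vars phi ++ free_vars psi
  | Exists x phi => [seq y <- free_vars phi | y != x]
  end.

Definition assignment : Type := nat -> word.

Definition update (e : assignment) (x : nat) (w : word) : assignment :=
  fun y => if y == x then w else e y.

Fixpoint eval (e : assignment) (t : term) : word :=
  match t with
  | Var x => e x
  | Eps => [::]
  | Zero => [:: letter0]
  | One => [:: letter1]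
  | Two => [:: letter2]
  | Cat s t => eval e s ++ eval e t
  end.

Definition atom_holds (e : assignment) (a : atom) : Prop :=
  match a with
  | Eq s t => eval e s = eval e t
  | LenLe s t => len_le (eval e s) (eval e t)
  | SameZeros s t => same_zeros (eval e s) (eval e t)
  end.

Fixpoint holds (e : assignment) (phi : eformula) : Prop :=
  match phi with
  | Atom a => atom_holds e a
  | NegAtom a => ~ atom_holds e a
  | And phi psi => holds e phi /\ holds e psi
  | Or phi psi => holds e phi \/ holds e psi
  | Exists x phi => exists w : word, holds (update e x w) phi
  end.

(* Only [x] may be free in [phi], so the values of [e] away from [x] are
   irrelevant to [holds (update e x w) phi]. *)
Definition existentially_definable (A : word -> Prop) : Prop :=
  exists (x : nat) (phi : eformula),
    {subset free_vars phi <= [:: x]} /\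
    forall (e : assignment) (w : word), holds (update e x w) phi <-> A w.

Definition binary_word (w : word) : Prop :=
  {subset w <= [:: letter0; letter1]}.

(* Main.v *)
Require Import Defs.
From mathcomp Require Import all_boot.
From mathcomp Require Import perm.

(** Fix [k] and exchange the letters 1 and 2 inside every maximal 0-free factor
    of length exactly [k].  This is an involution on words which preserves the
    length and the number of 0s.  It commutes with the concatenation [u ++ v]
    unless [k] is one of three lengths: the last 0-free factor of [u], the first
    one of [v], or the two together.  Hence, given an assignment satisfying an
    existential formula together with witnesses, the exchange yields another
    satisfying assignment for all but a number of [k] bounded by the formula
    alone.  The word 1^n 0 ... 1 1 0 1 0 has more 0-free factors of distinct
    lengths than this bound, so one of them can be turned into 2^k. *)

Set Implicit Arguments.
Unset Strict Implicit.
Unset Printing Implicit Defensive.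

Definition swap12 : letter -> letter := tperm letter1 letter2.

Lemma swap12K : involutive swap12.
Proof. exact: tpermK. Qed.

Lemma swap12_0 : swap12 letter0 = letter0.
Proof. by rewrite /swap12 tpermD. Qed.

Lemma swap12_eq0 c : (swap12 c == letter0) = (c == letter0).
Proof. by rewrite -{1}swap12_0 (inj_eq (inv_inj swap12K)). Qed.

Definition first_run (s : word) : nat := find (pred1 letter0) s.
Arguments first_run : simpl never.

Lemma first_run_cat u v :
  first_run (u ++ v) =
    if letter0 \in u then first_run u else size u + first_run v.
Proof. by rewrite /first_run find_cat has_pred1. Qed.

Lemma first_run_no0 s : letter0 \notin s -> first_run s = size s.
Proof. by rewrite -has_pred1 => /hasNfind. Qed.

Fixpoint last_run (n : nat) (s : word) : nat :=
  if s is c :: s' then last_run (if c == letter0 then 0 else n.+1) s' else n.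

(* [n] is the number of letters read since the last 0, so that
   [n + first_run s] is the length of the maximal 0-free factor around the head
   of [s] if that head is not 0. *)
Fixpoint flip (k n : nat) (s : word) : word :=
  if s is c :: s' then
    (if n + first_run s == k then swap12 c else c)
      :: flip k (if c == letter0 then 0 else n.+1) s'
  else [::].

Lemma flip_cons k n c s :
  flip k n (c :: s) =
    (if n + first_run (c :: s) == k then swap12 c else c)
      :: flip k (if c == letter0 then 0 else n.+1) s.
Proof. by []. Qed.

Lemma flip_head_eq0 (b : bool) c :
  ((if b then swap12 c else c) == letter0) = (c == letter0).
Proof. by case: b; rewrite ?swap12_eq0. Qed.

Lemma size_flip k n s : size (flip k n s) = size s.
Proof. by elim: s n => //= c s IHs n; rewrite IHs. Qed.

Lemma count_flip k n s :
  count_mem letter0 (flip k n s) = count_mem letter0 s.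
Proof. by elim: s n => //= c s IHs n; rewrite flip_head_eq0 IHs. Qed.

Lemma first_run_flip k n s : first_run (flip k n s) = first_run s.
Proof.
rewrite /first_run.
by elim: s n => //= c s IHs n; rewrite flip_head_eq0 IHs.
Qed.

(** The 0s stay in place, so the second pass sees the same factor lengths and exchanges the same
    letters back. *)
Lemma flipK k n : involutive (flip k n).
Proof.
move=> s; elim: s n => [//|c s IHs] n.
have := first_run_flip k n (c :: s); rewrite /= => ->.
rewrite flip_head_eq0 IHs; congr (_ :: _).
by case: (_ == k); rewrite ?swap12K.
Qed.

(** The offset matters only up to the first 0, which resets it; before that 0 neither side exchanges
    anything. *)
Lemma flip_offset k m n s :
  k != m + first_run s -> k != n + first_run s -> flip k m s = flip k n s.
Proof.
rewrite !(eq_sym k); elim: s m n => //= c s IHs m n.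
rewrite /first_run /=; case: (c =P letter0) => [-> | _] Hm Hn.
  by rewrite swap12_0 !if_same.
by rewrite (negPf Hm) (negPf Hn) (IHs m.+1 n.+1) // addSnnS.
Qed.

Lemma last_run_no0 n s : letter0 \notin s -> last_run n s = n + size s.
Proof.
elim: s n => [|c s IHs] n /=; first by rewrite addn0.
by rewrite inE eq_sym => /norP[/negPf-> /IHs->]; rewrite addSnnS.
Qed.

(** Only the factor across the border is at stake: the left side tests its full length, the right
    side those of its two pieces. As [k] is none of the three, its letters stay unchanged on both
    sides. *)
Lemma flip_cat k n u v :
  k \notin [:: last_run n u; first_run v; last_run n u + first_run v] ->
  flip k n (u ++ v) = flip k n u ++ flip k 0 v.
Proof.
rewrite !inE; elim: u n => [|c u IHu] n Hk.
  by case/norP: Hk => _ /norP[Hv Hnv]; apply: flip_offset.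
rewrite cat_cons !flip_cons {}IHu //=; congr (_ :: _).
rewrite -cat_cons first_run_cat; have [//|no0] := boolP (letter0 \in c :: u).
rewrite (first_run_no0 no0) addnA -(last_run_no0 n no0).
by case/norP: Hk => Hu /norP[_ Huv]; rewrite !ifN // eq_sym.
Qed.

Lemma flip_cat0 k n u s :
  flip k n (u ++ letter0 :: s) = flip k n u ++ letter0 :: flip k 0 s.
Proof.
elim: u n => [|c u IHu] n; first by rewrite /= swap12_0 if_same.
rewrite cat_cons !flip_cons IHu cat_cons; congr (_ :: _).
rewrite -cat_cons first_run_cat.
have [//|/first_run_no0->] := boolP (letter0 \in c :: u).
by rewrite /first_run /= addn0.
Qed.

(** [N] bounds how many exceptions there are, not how large they are: the exceptions vary with the
    assignment, their number must not. *)
Definition all_but (N : nat) (P : nat -> Prop) : Prop :=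
  exists2 bad : seq nat, size bad <= N & forall k, k \notin bad -> P k.

Lemma all_butT N (P : nat -> Prop) : (forall k, P k) -> all_but N P.
Proof. by exists [::]. Qed.

Lemma all_but_mono M N (P Q : nat -> Prop) :
  M <= N -> (forall k, P k -> Q k) -> all_but M P -> all_but N Q.
Proof.
move=> leMN PQ [bad Hbad HP]; exists bad; first exact: leq_trans leMN.
by move=> k /HP/PQ.
Qed.

Lemma all_but_and M N (P Q : nat -> Prop) :
  all_but M P -> all_but N Q -> all_but (M + N) (fun k => P k /\ Q k).
Proof.
move=> [b1 H1 HP] [b2 H2 HQ]; exists (b1 ++ b2); first by rewrite size_cat leq_add.
by move=> k; rewrite mem_cat => /norP[/HP ? /HQ ?].
Qed.

Lemma all_but_exists N (P : nat -> Prop) :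
  all_but N P -> exists2 k, 0 < k <= N.+1 & P k.
Proof.
case=> bad Hbad HP.
have /allPn[k]: ~~ all (mem bad) (iota 1 N.+1).
  apply/negP => /allP Hsub.
  have := uniq_leq_size (iota_uniq 1 N.+1) Hsub.
  by rewrite size_iota leqNgt ltnS Hbad.
by rewrite mem_iota add1n ltnS => Hk /HP; exists k.
Qed.

Definition flip_assignment (k : nat) (e : assignment) : assignment :=
  fun y => flip k 0 (e y).

(** Pointwise equality of [e'] is asked for because [update] and [flip_assignment] commute only
    pointwise, short of function extensionality. *)
Lemma eval_flip t :
  exists N, forall e, all_but N (fun k =>
    forall e', e' =1 flip_assignment k e -> eval e' t = flip k 0 (eval e t)).
Proof.
elim: t => [x|||||s [M Hs] t [N Ht]].
- by exists 0 => e; apply: all_butT => k e'; apply.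
- by exists 0 => e; apply: all_butT.
- by exists 0 => e; apply: all_butT => k e' _ /=; rewrite swap12_0 if_same.
(* The one-letter words 1 and 2 are altered only by [k = 1]. *)
- by exists 1 => e; exists [:: 1] => // k; rewrite inE eq_sym => /negPf /= ->.
- by exists 1 => e; exists [:: 1] => // k; rewrite inE eq_sym => /negPf /= ->.
exists (M + N + 3) => e.
pose bad : seq nat := [:: last_run 0 (eval e s); first_run (eval e t);
  last_run 0 (eval e s) + first_run (eval e t)].
have Hbad: all_but 3 (fun k => k \notin bad) by exists bad.
apply: (all_but_mono _ _ (all_but_and (all_but_and (Hs e) (Ht e)) Hbad)) => //.
by move=> k [[IHs IHt] Hk] e' He' /=; rewrite flip_cat // IHs // IHt.
Qed.

(** Equalities are reflected because an involution is injective. The equivalence, rather than one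
    implication, serves negated atoms. *)
Lemma atom_holds_flip a :
  exists N, forall e, all_but N (fun k =>
    forall e', e' =1 flip_assignment k e -> atom_holds e' a <-> atom_holds e a).
Proof.
by case: a => s t; have [M Hs] := eval_flip s; have [N Ht] := eval_flip t;
  exists (M + N) => e; apply: (all_but_mono _ _ (all_but_and (Hs e) (Ht e)));
  rewrite // => k [Es Et] e' He' /=;
  rewrite /len_le /same_zeros Es // Et // ?size_flip ?count_flip //;
  split=> [/(inv_inj (flipK k 0))|->].
Qed.

Lemma holds_flip phi :
  exists N, forall e, holds e phi -> all_but N (fun k =>
    forall e', e' =1 flip_assignment k e -> holds e' phi).
Proof.
elim: phi => [a|a|p [M Hp] q [N Hq]|p [M Hp] q [N Hq]|x p [N Hp]].
- have [N Ha] := atom_holds_flip a; exists N => e He.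
  by apply: all_but_mono (Ha e) => // k Hk e' /Hk [_]; apply.
- have [N Ha] := atom_holds_flip a; exists N => e He.
  by apply: all_but_mono (Ha e) => // k Hk e' /Hk [He' _] /= /He'.
- exists (M + N) => e [/Hp Hep /Hq Heq].
  apply: all_but_mono (all_but_and Hep Heq) => // k [Hk1 Hk2] e' He'.
  by split; [apply: Hk1 | apply: Hk2].
- exists (M + N) => e [/Hp | /Hq].
    by apply: all_but_mono; [apply: leq_addr | move=> k Hk e' /Hk; left].
  by apply: all_but_mono; [apply: leq_addl | move=> k Hk e' /Hk; right].
(* The exceptional [k] depend on the witness [w], but the bound [N] does not; the exchanged [w] is
   the new witness. *)
exists N => e [w /Hp]; apply: all_but_mono => // k Hk e' He'.
exists (flip k 0 w); apply: Hk => y.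
by rewrite /flip_assignment /update; case: ifP.
Qed.

Fixpoint staircase (n : nat) : word :=
  if n is n'.+1 then nseq n letter1 ++ letter0 :: staircase n' else [::].

Lemma staircase_binary n : binary_word (staircase n).
Proof.
elim: n => [|n IHn] c //; rewrite mem_cat mem_nseq inE => /or3P[/eqP->|/eqP->|/IHn] //.
Qed.

Lemma flip_staircase k n : 0 < k <= n -> letter2 \in flip k 0 (staircase n).
Proof.
elim: n => [|n IHn]; first by rewrite leqn0 lt0n => /andP[/negPf->].
case/andP=> k_gt0; rewrite leq_eqVlt.
rewrite -[staircase _]/(nseq n.+1 letter1 ++ letter0 :: staircase n) flip_cat0.
case/predU1P=> [->|le_k_n]; last first.
  by rewrite mem_cat [_ \in letter0 :: _]inE IHn ?orbT // k_gt0.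
have Hrun: first_run (nseq n.+1 letter1) = n.+1.
  by rewrite /first_run hasNfind ?size_nseq // has_nseq.
have ->: flip n.+1 0 (nseq n.+1 letter1) = letter2 :: flip n.+1 1 (nseq n letter1).
  by rewrite [LHS]flip_cons Hrun eqxx /swap12 tpermL.
by rewrite inE eqxx.
Qed.

Theorem theorem8 : ~ existentially_definable binary_word.
Proof.
case=> x [phi [_ Hphi]]; have [N HN] := holds_flip phi.
(* With at most [N] exceptions, some [k] among 1, ..., [N.+1] is good, and [w] has a block of each
   of these lengths. *)
pose e : assignment := fun=> [::]; pose w := staircase N.+1.
have /HN/all_but_exists[k Hk Hflip] : holds (update e x w) phi.
  by apply/Hphi/staircase_binary.
have Hw: binary_word (flip k 0 w).
  apply/(Hphi e)/Hflip => y.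
  by rewrite /flip_assignment /update; case: ifP.
by have := Hw _ (flip_staircase Hk).
Qed.
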